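(* Let $\mathcal{D}$ be the mirror Heisenberg-Virasoro algebra over $\mathbb{C}$, and let $\mathfrak{GDer}(\mathcal{D})\subseteq \operatorname{End}_{\mathbb{C}}(\mathcal{D})$ be the space of generalized derivations of $\mathcal{D}$. Then, as an internal direct sum of subspaces of $\operatorname{End}_{\mathbb{C}}(\mathcal{D})$, $$\mathfrak{GDer}(\mathcal{D})=\mathbb{C}\tau\oplus\mathbb{C}\,\mathrm{id}_{\mathcal{D}}\oplus\mathrm{Inn}(\mathcal{D})\oplus\mathrm{Ann}(\mathcal{D}).$$
   Context: All vector spaces are over $\mathbb{C}$. The mirror Heisenberg-Virasoro algebra $\mathcal{D}$ is the complex Lie algebra with basis $\{L_m,\mathbf{c}\mid m\in\mathbb{Z}\}\cup\{I_r,\mathbf{l}\mid r\in\frac12+\mathbb{Z}\}$ and non-vanishing brackets $$[L_m,L_n]=(m-n)L_{m+n}+\delta_{m+n,0}\tfrac{m^3-m}{12}\mathbf{c},\quad [L_m,I_r]=-rI_{m+r},\quad [I_r,I_s]=r\delta_{r+s,0}\mathbf{l},$$ for $m,n\in\mathbb{Z}$, $r,s\in\frac12+\mathbb{Z}$ (so $\mathbf{c},\mathbf{l}$ are central). For a Lie algebra $\mathfrak{g}$, let $\Delta(\mathfrak{g})$ be the set of triples $(f,f',f'')$ of linear endomorphisms of $\mathfrak{g}$ with $[f(x),y]+[x,f'(y)]=f''([x,y])$ for all $x,y\in\mathfrak{g}$. A linear map $f\in\operatorname{End}(\mathfrak{g})$ is a generalized derivation if there exist $f',f''\in\operatorname{End}(\mathfrak{g})$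 with $(f,f',f'')\in\Delta(\mathfrak{g})$. $\mathrm{Inn}(\mathcal{D})$ is the space of inner derivations of $\mathcal{D}$. $\mathrm{Ann}(\mathcal{D})=\{f\in\operatorname{End}_{\mathbb{C}}(\mathcal{D})\mid f(\mathcal{D})\subseteq\mathbb{C}\mathbf{c}\oplus\mathbb{C}\mathbf{l}\}$. The linear map $\tau$ on $\mathcal{D}$ is the derivation defined by $\tau(L_m)=\tau(\mathbf{c})=0$, $\tau(I_r)=I_r$, $\tau(\mathbf{l})=2\mathbf{l}$. *)

(* Defs.v *)
From HB Require Import structures.
From mathcomp Require Import all_boot all_order all_algebra.
From mathcomp Require Import boolp classical_sets functions reals.
From mathcomp Require Import complex.
From mathcomp Require Import freeg.
From mathcomp Require Import ring zify.

Set Implicit Arguments.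
Unset Strict Implicit.
Unset Printing Implicit Defensive.

Import Order.TTheory GRing.Theory Num.Theory.

Local Open Scope classical_set_scope.
Local Open Scope ring_scope.

Section DirectSum.
Variables (K : fieldType) (V : lmodType K).

(* The endomorphisms of a vector space g are the functions satisfying linear
   inside the vector space g -> g; direct sums of spaces of endomorphisms are
   taken there. *)
Definition subspace (U : set V) : Prop :=
  U 0 /\ forall (a : K) (u v : V), U u -> U v -> U (a *: u + v).

Definition line (v : V) : set V := [set a *: v | a in [set: K]].

Definition in_summands (Us : seq (set V)) (u : 'I_(size Us) -> V) : Prop :=
  forall i : 'I_(size Us), nth set0 Us i (u i).

Definition internal_direct_sum (Us : seq (set V)) (W : set V) : Prop :=
  [/\ forall i : 'I_(size Us), subspace (nth set0 Us i),
      W = [set \sum_i u i | u in @in_summands Us] &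
      forall u : 'I_(size Us) -> V, in_summands u ->
        \sum_i u i = 0 -> forall i, u i = 0].

End DirectSum.

HB.mixin Record Lmodule_isLieAlgebra (K : fieldType) g of GRing.Lmodule K g := {
  lie : g -> g -> g;
  lie_linearl : forall y, linear (fun x => lie x y);
  lie_linearr : forall x, linear (lie x);
  liexx : forall x, lie x x = 0;
  lie_jacobi : forall x y z,
    lie x (lie y z) + lie y (lie z x) + lie z (lie x y) = 0
}.

#[short(type="lieAlgType")]
HB.structure Definition LieAlgebra (K : fieldType) :=
  { g of Lmodule_isLieAlgebra K g & GRing.Lmodule K g }.

Section LieAlgebraMaps.
Variables (K : fieldType) (g : lieAlgType K).

Definition Delta : set ((g -> g) * (g -> g) * (g -> g)) :=
  [set t | let: (f, f', f'') := t in
    [/\ linear f, linear f', linear f'' &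
        forall x y, lie (f x) y + lie x (f' y) = f'' (lie x y)]].

Definition generalized_derivations : set (g -> g) :=
  [set f | exists f' f'' : g -> g, Delta (f, f', f'')].

Definition derivations : set (g -> g) :=
  [set f | linear f /\
    forall x y, f (lie x y) = lie (f x) y + lie x (f y)].

(* x ranges over g, giving ad x = [x, -]. *)
Definition inner_derivations : set (g -> g) := range (@lie K g).

End LieAlgebraMaps.

Arguments Delta {K} g.
Arguments generalized_derivations {K} g.
Arguments derivations {K} g.
Arguments inner_derivations {K} g.

Section Freeg.
Variables (R : nzRingType) (B : choiceType) (M : lmodType R).
Implicit Types (f : B -> M) (x : {freeg B / R}).

HB.instance Definition _ f :=
  GRing.isZmodMorphism.Build {freeg B / R} M (fglift f) (lift_is_additive f).

Lemma fgliftE f x : fglift f x = \sum_(b <- dom x) coeff b x *: f b.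
Proof.
rewrite -{1}(freeg_sumE x) raddf_sum; apply: eq_bigr => b _.
exact: liftU.
Qed.

Lemma fglift_linear f : linear (fglift f).
Proof.
move=> a x y; rewrite raddfD /=; congr (_ + _).
rewrite -{1}(freeg_sumE x) scaler_sumr raddf_sum (fgliftE f x) scaler_sumr.
apply: eq_bigr => b _; rewrite scalerA -(liftU f).
congr (fglift f _); apply/eqP/freeg_eqP => k.
by rewrite coeffZ !coeffU mulrA.
Qed.

Lemma freeg_linearE (h : {freeg B / R} -> M) :
  linear h -> h =1 fglift (fun b => h << b >>).
Proof.
move=> lh x.
have hD : {morph h : u v / u + v}.
  by move=> u v; have := lh 1 u v; rewrite !scale1r.
have h0 : h 0 = 0 by apply: (addrI (h 0)); rewrite -hD !addr0.
rewrite fgliftE -{1}(freeg_sumE x) (big_morph h hD h0).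
apply: eq_bigr => b _.
rewrite -[RHS]addr0 -[X in _ + X]h0 -lh addr0; congr (h _).
by apply/eqP/freeg_eqP => k; rewrite coeffZ !coeffU mul1r.
Qed.

Lemma freeg_linear_ext (h1 h2 : {freeg B / R} -> M) :
  linear h1 -> linear h2 -> (forall b, h1 << b >> = h2 << b >>) -> h1 =1 h2.
Proof.
move=> l1 l2 e x; rewrite (freeg_linearE l1) (freeg_linearE l2) !fgliftE.
by apply: eq_bigr => b _; rewrite e.
Qed.

End Freeg.

Section FreegBracket.
Variables (K : fieldType) (B : choiceType).
Variable t : B -> B -> {freeg B / K}.
Local Notation V := {freeg B / K}.
Implicit Types x y z : V.

(* Bilinear extension of t. *)
Definition freeg_bracket x y : V := fglift (fun a => fglift (t a) y) x.

Lemma freeg_bracketE a b : freeg_bracket << a >> << b >> = t a b.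
Proof. by rewrite /freeg_bracket !liftU !scale1r. Qed.

Lemma freeg_bracket_linearl y : linear (fun x => freeg_bracket x y).
Proof. exact: fglift_linear. Qed.

Lemma freeg_bracket_linearr x : linear (freeg_bracket x).
Proof.
move=> a y z; rewrite /freeg_bracket !fgliftE scaler_sumr -big_split /=.
apply: eq_bigr => b _; rewrite fglift_linear scalerDr !scalerA.
by rewrite mulrC.
Qed.

Lemma freeg_bracketC : (forall a b, t a b = - t b a) ->
  forall x y, freeg_bracket x y = - freeg_bracket y x.
Proof.
move=> tC x y; move: x; apply: freeg_linear_ext => [||a].
- exact: freeg_bracket_linearl.
- by move=> k u v; rewrite freeg_bracket_linearr opprD scalerN.
move: y; apply: freeg_linear_ext => [||b].
- exact: freeg_bracket_linearr.
- by move=> k u v; rewrite freeg_bracket_linearl opprD scalerN.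
by rewrite !freeg_bracketE.
Qed.

Lemma freeg_bracketxx : 2 != 0 :> K -> (forall a b, t a b = - t b a) ->
  forall x, freeg_bracket x x = 0.
Proof.
move=> K2 tC x; apply/eqP; have /eqP := freeg_bracketC tC x x.
by rewrite -addr_eq0 -mulr2n -scaler_nat scaler_eq0 (negPf K2).
Qed.

Lemma freeg_bracket_jacobi :
    (forall a b c, freeg_bracket << a >> (t b c) +
       freeg_bracket << b >> (t c a) + freeg_bracket << c >> (t a b) = 0) ->
  forall x y z, freeg_bracket x (freeg_bracket y z) +
    freeg_bracket y (freeg_bracket z x) +
    freeg_bracket z (freeg_bracket x y) = 0.
Proof.
have Dl := freeg_bracket_linearl; have Dr := freeg_bracket_linearr.
have lin0 : linear (fun _ : V => 0 : V) by move=> k u v /=; rewrite scaler0 addr0.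
have AC (k : K) (p q r p' q' r' : V) :
    k *: p + p' + (k *: q + q') + (k *: r + r') =
    k *: (p + q + r) + (p' + q' + r').
  by rewrite (addrACA _ p') (addrACA _ (p' + _)) -!scalerDr.
move=> J x y z; move: x; apply: freeg_linear_ext => [|//|a].
  by move=> k u v; rewrite !(Dl, Dr) AC.
move: y; apply: freeg_linear_ext => [|//|b].
  by move=> k u v; rewrite !(Dl, Dr) AC.
move: z; apply: freeg_linear_ext => [|//|c].
  by move=> k u v; rewrite !(Dl, Dr) AC.
by rewrite !freeg_bracketE.
Qed.

End FreegBracket.

(* I_ k stands for the basis vector I_r with r = k + 1/2. *)
Inductive mhv_basis : Type := L_ of int | c_ | I_ of int | l_.

Definition mhv_basis_code (b : mhv_basis) : int + int + bool :=
  match b with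
  | L_ m => inl (inl m) | I_ k => inl (inr k) | c_ => inr true | l_ => inr false
  end.
Definition mhv_basis_decode (s : int + int + bool) : mhv_basis :=
  match s with
  | inl (inl m) => L_ m | inl (inr k) => I_ k
  | inr true => c_ | inr false => l_
  end.
Lemma mhv_basis_codeK : cancel mhv_basis_code mhv_basis_decode.
Proof. by case. Qed.
HB.instance Definition _ := Choice.copy mhv_basis (can_type mhv_basis_codeK).

Section MirrorHeisenbergVirasoro.
Variable R : realType.
Local Notation C := R[i].

Definition mhv := {freeg mhv_basis / C}.
HB.instance Definition _ := GRing.Lmodule.on mhv.

Definition mhv_vec (b : mhv_basis) : mhv := << b >>.
Local Notation "''e' b" := (mhv_vec b) (at level 8, b at level 2).

(* The index r of I_r, seen in C. *)
Definition half_int (k : int) : C := k%:~R + 1 / 2.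

Definition mhv_lie_basis (a b : mhv_basis) : mhv :=
  match a, b with
  | L_ m, L_ n => (m - n)%:~R *: 'e (L_ (m + n))
      + (if m + n == 0 then (m%:~R ^+ 3 - m%:~R) / 12 else 0) *: 'e c_
  | L_ m, I_ k => - half_int k *: 'e (I_ (m + k))
  | I_ k, L_ m => half_int k *: 'e (I_ (m + k))
  (* r + s = 0 for r = j + 1/2 and s = k + 1/2 *)
  | I_ j, I_ k => (if j + k + 1 == 0 then half_int j else 0) *: 'e l_
  | _, _ => 0
  end.

Lemma mhv_lie_basisC a b : mhv_lie_basis a b = - mhv_lie_basis b a.
Proof.
case: a b => [m||j|] [n||k|] //=; rewrite ?oppr0 ?scaleNr ?opprK //.
  rewrite opprD -!scaleNr [n + m]addrC; congr (_ *: _ + _ *: _).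
    by rewrite -rmorphN /= opprB.
  case: eqP => [h|]; last by rewrite oppr0.
  have -> : n = - m by lia.
  by rewrite mulrNz; ring.
rewrite -scaleNr [k + j]addrC; congr (_ *: _).
case: eqP => [h|]; last by rewrite oppr0.
have -> : k = - j - 1 by lia.
by rewrite /half_int mulrzBr mulrNz; field.
Qed.

Let br := freeg_bracket mhv_lie_basis.

Let brr a x y k l : br << a >> (k *: x + l *: y) =
  k *: br << a >> x + l *: br << a >> y.
Proof.
have br0 : br << a >> 0 = 0.
  have := freeg_bracket_linearr mhv_lie_basis << a >> (-1) 0 0.
  by rewrite scaler0 addr0 scaleN1r addNr.
rewrite /br freeg_bracket_linearr; congr (_ + _).
by have := freeg_bracket_linearr mhv_lie_basis << a >> l y 0;
  rewrite !addr0 => ->; rewrite [X in _ + X]br0 addr0.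
Qed.

Let br1 a x k : br << a >> (k *: x) = k *: br << a >> x.
Proof. by have := brr a x x k 0; rewrite !scale0r !addr0. Qed.

Let br0 a : br << a >> 0 = 0.
Proof. by have := br1 a 0 0; rewrite !scale0r. Qed.

Let brE a b : br << a >> ('e b) = mhv_lie_basis a b.
Proof. exact: freeg_bracketE. Qed.

Let jac a b c := br << a >> (mhv_lie_basis b c) +
  br << b >> (mhv_lie_basis c a) + br << c >> (mhv_lie_basis a b) = 0.

Let jac_rot a b c : jac b c a -> jac a b c.
Proof. by rewrite /jac -[_ + _ + br << c >> _]addrA [_ + (_ + br << c >> _)]addrC. Qed.

Let comb3 (u v : mhv) (k1 k2 k3 l1 l2 l3 : C) :
  k1 + k2 + k3 = 0 -> l1 + l2 + l3 = 0 ->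
  (k1 *: u + l1 *: v) + (k2 *: u + l2 *: v) + (k3 *: u + l3 *: v) = 0.
Proof.
move=> hk hl; rewrite (addrACA (k1 *: u)) -!scalerDl (addrACA (_ *: u)) -!scalerDl.
rewrite hk hl.
by rewrite !scale0r addr0.
Qed.

Let jac_LLL m n p : jac (L_ m) (L_ n) (L_ p).
Proof.
rewrite /jac /= !brr !brE /= !scaler0 !addr0 !scalerDr !scalerA.
have -> : n + (p + m) = m + (n + p) by lia.
have -> : p + (m + n) = m + (n + p) by lia.
apply: comb3; rewrite !(mulrzBr, mulrzDr); first by ring.
case: eqP => [h|_]; last by rewrite !mulr0 !addr0.
have -> : p = - (m + n) by lia.
by rewrite !(mulrNz, mulrzDr); field.
Qed.

Let jac_LLI m n k : jac (L_ m) (L_ n) (I_ k).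
Proof.
rewrite /jac /= !(br1, brr) !brE /= !scaler0 !addr0 !scalerA.
have -> : n + (m + k) = m + (n + k) by lia.
have -> : m + n + k = m + (n + k) by lia.
rewrite -!scalerDl /half_int !(mulrzBr, mulrzDr).
by apply/eqP; rewrite scaler_eq0; apply/orP; left; apply/eqP; field.
Qed.

Let jac_LII m j k : jac (L_ m) (I_ j) (I_ k).
Proof.
rewrite /jac /= !br1 !brE /= !scaler0 add0r !scalerA -scalerDl.
have -> : k + (m + j) = j + (m + k) by lia.
case: eqP => [h|_]; last by rewrite !mulr0 addr0 scale0r.
by apply/eqP; rewrite scaler_eq0; apply/orP; left; apply/eqP; ring.
Qed.

Let jacP a b c : jac a b c.
Proof.
case: a b c => [m||j|] [n||k|] [p||q|]; lazymatch goal with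
  | |- jac (L_ _) (L_ _) (L_ _) => exact: jac_LLL
  | |- jac (L_ _) (L_ _) (I_ _) => exact: jac_LLI
  | |- jac (L_ _) (I_ _) (L_ _) => do 2 apply: jac_rot; exact: jac_LLI
  | |- jac (I_ _) (L_ _) (L_ _) => apply: jac_rot; exact: jac_LLI
  | |- jac (L_ _) (I_ _) (I_ _) => exact: jac_LII
  | |- jac (I_ _) (L_ _) (I_ _) => apply: jac_rot; exact: jac_LII
  | |- jac (I_ _) (I_ _) (L_ _) => apply: jac_rot; apply: jac_rot; exact: jac_LII
  | |- _ => by rewrite /jac /= ?(br1, brr, br0, brE) /= ?scaler0 ?addr0
  end.
Qed.

Let two_neq0 : 2 != 0 :> C. Proof. by rewrite pnatr_eq0. Qed.

HB.instance Definition _ := @Lmodule_isLieAlgebra.Build C mhv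
  (freeg_bracket mhv_lie_basis)
  (freeg_bracket_linearl mhv_lie_basis)
  (freeg_bracket_linearr mhv_lie_basis)
  (freeg_bracketxx two_neq0 mhv_lie_basisC)
  (freeg_bracket_jacobi jacP).

Lemma mhv_lieE a b : lie ('e a) ('e b) = mhv_lie_basis a b.
Proof. exact: freeg_bracketE. Qed.

Definition tau_basis (b : mhv_basis) : mhv :=
  match b with L_ _ | c_ => 0 | I_ k => 'e (I_ k) | l_ => 2 *: 'e l_ end.

Definition tau : mhv -> mhv := fglift tau_basis.

Lemma tauE b : tau ('e b) = tau_basis b.
Proof. by rewrite /tau liftU scale1r. Qed.

Lemma tau_linear : linear tau.
Proof. exact: fglift_linear. Qed.

Lemma tau_derivation : derivations mhv tau.
Proof.
have Dl (y : mhv) : linear (fun x : mhv => lie x y) := lie_linearl y.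
have Dr (x : mhv) : linear (fun y : mhv => lie x y) := lie_linearr x.
split=> [|x y]; first exact: tau_linear.
move: x; apply: freeg_linear_ext => [||a].
- by move=> k u v; rewrite Dl tau_linear.
- by move=> k u v; rewrite tau_linear !Dl addrACA scalerDr.
move: y; apply: freeg_linear_ext => [||b].
- by move=> k u v; rewrite Dr tau_linear.
- by move=> k u v; rewrite tau_linear !Dr addrACA scalerDr.
rewrite -!/(mhv_vec _) mhv_lieE !tauE.
have lZl k u v : lie (k *: u) v = k *: lie u v :> mhv.
  exact: (GRing.scalable_linear (Dl v)).
have lZr k u v : lie v (k *: u) = k *: lie v u :> mhv.
  exact: (GRing.scalable_linear (Dr v)).
have l0l v : lie 0 v = 0 :> mhv by rewrite -[X in lie X v](scale0r (0 : mhv)) lZl scale0r.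
have l0r v : lie v 0 = 0 :> mhv by rewrite -[X in lie v X](scale0r (0 : mhv)) lZr scale0r.
have tZ k u : tau (k *: u) = k *: tau u.
  exact: (GRing.scalable_linear tau_linear).
have tD u v : tau (u + v) = tau u + tau v.
  by have := tau_linear 1 u v; rewrite !scale1r.
have t0 : tau 0 = 0 by rewrite -[X in tau X](scale0r (0 : mhv)) tZ scale0r.
case: a b => [m||j|] [n||k|] /=;
  rewrite ?(lZl, lZr, l0l, l0r, mhv_lieE) /= ?(tD, tZ, t0, tauE) /=;
  rewrite ?scaler0 ?addr0 ?add0r //.
by rewrite scalerA mulr_natr mulr2n scalerDl.
Qed.

Definition Ann : set (mhv -> mhv) :=
  [set f | linear f /\
    forall x, [set a *: 'e c_ + b *: 'e l_ | a in [set: C] & b in [set: C]] (f x)].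

End MirrorHeisenbergVirasoro.

Arguments Ann R : clear implicits.

(* Main.v *)
Require Import Defs.
From mathcomp Require Import all_boot all_order all_algebra.
From mathcomp Require Import boolp classical_sets functions reals.
From mathcomp Require Import complex.
From mathcomp Require Import freeg ring zify.

(** Why the theorem is true.  Let [(f, g, h)] be a triple in [Delta].  Swapping
    the arguments of the bracket shows that [(g, f, h)] is one too
    ([Delta_swap]), so whatever is proved for [f] holds for [g].

    Write the defining identity on pairs of basis vectors and compare
    coefficients.  The brackets are homogeneous, so each identity relates only
    the coefficients of one fixed degree shift [d], and no decomposition of [f]
    into homogeneous pieces (an infinite sum in general) is ever needed.
    The operators [ad x] account exactly for the coefficients of [f (L_ 0)] of
    nonzero degree, because [[x, L_0]] multiplies the coordinate of degree [r]
    of [x] by [r].  So subtract one inner derivation to make [f (L_ 0)] a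
    multiple of [L_ 0] modulo the center ([exists_inner_part]).  After this
    normalization:
    - the [l_]-coefficient of the identity for [L_ m, I_ j] says that the
      component of [f (L_ m)] along the [I]'s, of given degree shift, does not
      depend on [m]; hence it vanishes ([Delta_LI_coeff]);
    - the identity for [L_ m, I_ j] rules out components of [f (I_ j)] along
      the [L]'s ([Delta_IL_coeff]);
    - in a given shift [d] the same identity reads
      [phi m + psi j = eta (m + j)], so [f] is affine in the index on the [L]'s
      and, up to a factor, [g] is affine on the [I]'s ([Delta_affine]);
    - for [d != 0] the central charges finish the job: the cubic cocycle in
      [[L_m, L_n]] is incompatible with a nonzero slope ([Delta_LL_off]), and
      the form [[I_r, I_s]] kills what is left on the [I]'s ([Delta_II_off]);
    - for [d = 0] one finds [a + s m] on [L_ m] and [b + s r] on [I_r], with the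
      same slope ([Delta_diag]): this is [a id + (b - a) tau - s ad L_0].
    What remains takes values in the center.  The sum is direct because the
    coefficients of [t tau + a id + ad x] at [L_0], [L_1] and [I_0] recover
    [a], then [x] modulo the center, then [t] ([summands_independent]). *)

Set Implicit Arguments.
Unset Strict Implicit.
Unset Printing Implicit Defensive.

Import Order.TTheory GRing.Theory Num.Theory.

Local Open Scope classical_set_scope.
Local Open Scope ring_scope.

(** * Generalized derivations of a Lie algebra *)

Section LinearMaps.
Variables (K : fieldType) (U V : lmodType K) (f : U -> V).
Hypothesis lin_f : linear f.

Lemma linear_mapD u v : f (u + v) = f u + f v.
Proof. by have := lin_f 1 u v; rewrite !scale1r. Qed.

Lemma linear_map0 : f 0 = 0.
Proof. by apply: (addrI (f 0)); rewrite -linear_mapD !addr0. Qed.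

Lemma linear_mapZ a u : f (a *: u) = a *: f u.
Proof. by rewrite -[a *: u]addr0 lin_f linear_map0 addr0. Qed.

Lemma linear_mapN u : f (- u) = - f u.
Proof. by rewrite -scaleN1r linear_mapZ scaleN1r. Qed.

End LinearMaps.

Lemma linear_comb (K : fieldType) (U V : lmodType K) (a : K) (f1 f2 : U -> V) :
  linear f1 -> linear f2 -> linear (a *: f1 + f2).
Proof.
move=> l1 l2 k u v; rewrite !fctE l1 l2 !scalerDr !scalerA mulrC.
by rewrite addrACA.
Qed.

Section LieAlgebraFacts.
Variables (K : fieldType) (g : lieAlgType K).
Implicit Types (x y : g) (f : g -> g).

Lemma lieC x y : lie x y = - lie y x.
Proof.
apply/eqP; rewrite -addr_eq0; apply/eqP.
have := liexx (x + y).
rewrite (linear_mapD (lie_linearl _)) !(linear_mapD (lie_linearr _)) !liexx.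
by rewrite add0r addr0.
Qed.

Lemma Delta_comb (a : K) f1 f1' f1'' f2 f2' f2'' :
  Delta g (f1, f1', f1'') -> Delta g (f2, f2', f2'') ->
  Delta g (a *: f1 + f2, a *: f1' + f2', a *: f1'' + f2'').
Proof.
move=> [l1 l1' l1'' D1] [l2 l2' l2'' D2]; split; try exact: linear_comb.
move=> x y; rewrite !fctE (lie_linearl y) (lie_linearr x) -D1 -D2 scalerDr.
by rewrite addrACA.
Qed.

Lemma generalized_derivation_comb (a : K) f1 f2 :
  generalized_derivations g f1 -> generalized_derivations g f2 ->
  generalized_derivations g (a *: f1 + f2).
Proof.
move=> [f1' [f1'' D1]] [f2' [f2'' D2]].
by exists (a *: f1' + f2'), (a *: f1'' + f2''); apply: Delta_comb.
Qed.

Lemma generalized_derivation0 : generalized_derivations g 0.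
Proof.
have l0 : linear (0 : g -> g) by move=> k u v; rewrite /= scaler0 addr0.
exists 0, 0; split=> // x y.
by rewrite (linear_map0 (lie_linearl _)) (linear_map0 (lie_linearr _)) addr0.
Qed.

Lemma derivation_generalized f :
  derivations g f -> generalized_derivations g f.
Proof. by move=> [lf df]; exists f, f; split=> // x y; rewrite df. Qed.

Lemma inner_derivation x : derivations g (lie x).
Proof.
split=> [|y z]; first exact: lie_linearr.
have := lie_jacobi x y z.
rewrite (lieC z x) (lieC z (lie x y)) (linear_mapN (lie_linearr _)).
by move/eqP; rewrite subr_eq0 subr_eq => /eqP ->; rewrite addrC.
Qed.

(** The companions of the identity are 0 and the identity: [[x, y] + 0 = [x, y]]. *)
Lemma id_generalized : generalized_derivations g idfun.
Proof.
exists (0 : g -> g), idfun; split=> //.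
- by move=> k u v; rewrite /= scaler0 addr0.
- by move=> x y; rewrite (linear_map0 (lie_linearr _)) addr0.
Qed.

(** Antisymmetry of the bracket exchanges the roles of the first two maps, so
    every conclusion about the first map of a triple also holds for the second. *)
Lemma Delta_swap f f' f'' : Delta g (f, f', f'') -> Delta g (f', f, f'').
Proof.
move=> [l l' l'' D]; split=> // x y.
by rewrite (lieC x y) (linear_mapN l'') -D opprD addrC !(lieC (f' _), lieC x).
Qed.

Lemma subspace_line (v : g -> g) : subspace (line v).
Proof.
split; first by exists 0; rewrite ?scale0r.
by move=> a _ _ [b _ <-] [c _ <-]; exists (a * b + c) => //; rewrite scalerDl scalerA.
Qed.

Lemma subspace_inner_derivations : subspace (inner_derivations g).
Proof.
split; first by exists 0 => //; apply/funext => y; exact: (linear_map0 (lie_linearl y)).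
move=> a _ _ [x _ <-] [y _ <-]; exists (a *: x + y) => //.
by apply/funext => z; exact: (lie_linearl z).
Qed.

End LieAlgebraFacts.

Section FourSummands.
Variables (K : fieldType) (V : lmodType K) (U1 U2 U3 U4 W : set V).

(** Families indexed by ordinals are awkward to handle by hand; this trades
    them for four named vectors. *)
Lemma internal_direct_sum4 :
  [/\ subspace U1, subspace U2, subspace U3 & subspace U4] ->
  (forall u1 u2 u3 u4, U1 u1 -> U2 u2 -> U3 u3 -> U4 u4 -> W (u1 + u2 + u3 + u4)) ->
  (forall w, W w -> exists u1 u2 u3 u4,
     [/\ U1 u1, U2 u2, U3 u3 & U4 u4] /\ w = u1 + u2 + u3 + u4) ->
  (forall u1 u2 u3 u4, U1 u1 -> U2 u2 -> U3 u3 -> U4 u4 ->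
     u1 + u2 + u3 + u4 = 0 -> [/\ u1 = 0, u2 = 0, u3 = 0 & u4 = 0]) ->
  internal_direct_sum [:: U1; U2; U3; U4] W.
Proof.
move=> [s1 s2 s3 s4] sumW decW dir.
have sum4 (u : 'I_4 -> V) :
    \sum_i u i = u 0 + u 1 + u (inord 2) + u (inord 3).
  rewrite !big_ord_recl big_ord0 addr0 !addrA.
  by congr (u _ + u _ + u _ + u _); apply/val_inj; rewrite /= ?inordK.
have sumE (u : 'I_4 -> V) : @in_summands _ _ [:: U1; U2; U3; U4] u ->
    [/\ U1 (u 0), U2 (u 1), U3 (u (inord 2)) & U4 (u (inord 3))].
  move=> us; split; first exact: (us 0); first exact: (us 1).
    by have := us (inord 2); rewrite inordK.
  by have := us (inord 3); rewrite inordK.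
split.
- by case=> [[|[|[|[|//]]]] Hi].
- apply/seteqP; split=> [w /decW [u1 [u2 [u3 [u4 [[h1 h2 h3 h4] ->]]]]] | w [u /sumE[h1 h2 h3 h4] <-]].
    exists (fun i : 'I_4 => nth 0 [:: u1; u2; u3; u4] i).
      by case=> [[|[|[|[|//]]]] Hi].
    by rewrite sum4 !inordK.
  by rewrite sum4; exact: sumW.
- move=> u us; rewrite sum4 => u0; have [h1 h2 h3 h4] := sumE u us.
  have [e1 e2 e3 e4] := dir _ _ _ _ h1 h2 h3 h4 u0.
  case=> [[|[|[|[|//]]]] Hi]; [rewrite -e1|rewrite -e2|rewrite -e3|rewrite -e4];
   by congr u; apply/val_inj; rewrite /= ?inordK.
Qed.

End FourSummands.

(** * Half-integers and affine sequences *)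

Section HalfIntegers.
Variable R : realType.
Local Notation C := R[i].

Lemma half_int_neq0 k : half_int R k != 0.
Proof.
have -> : half_int R k = (2 * k + 1)%:~R / 2 by rewrite /half_int; field.
by rewrite mulf_neq0 ?invr_eq0 ?pnatr_eq0 // intr_eq0; lia.
Qed.

Lemma half_int_opp k : half_int R (- k - 1) = - half_int R k.
Proof. by rewrite /half_int; field. Qed.

(** Replacing [(m + 1, 0)] by [(m, 1)] leaves [eta] unchanged, so the increments
    of [phi] are constant, and [psi] has the same increments. *)
Lemma affine_of_sum (phi psi eta : int -> C) :
  (forall m j, phi m + psi j = eta (m + j)) ->
  let s := phi 1 - phi 0 in
  (forall m, phi m = phi 0 + s * m%:~R) /\
  (forall j, psi j = psi 0 + s * j%:~R).
Proof.
move=> E /=.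
have psi1 : psi 1 = phi 1 + psi 0 - phi 0.
  by rewrite E -[X in X - _](E 0 1) addrAC subrr add0r.
have S m : phi (m + 1) = phi m + (phi 1 - phi 0).
  apply: (addIr (psi 0)); rewrite E addr0 -E psi1; ring.
have P m : phi m = phi 0 + (phi 1 - phi 0) * m%:~R.
  elim/int_ind: m => [|n IH|n IH]; first by rewrite mulr0 addr0.
  - by rewrite -addn1 PoszD S IH; ring.
  - have := S (- n.+1%:Z); have -> : - n.+1%:Z + 1 = - n%:Z by lia.
    rewrite IH => /eqP; rewrite -subr_eq => /eqP <-.
    by rewrite -addn1 PoszD; ring.
split=> // j; apply: (addrI (phi 0)).
by rewrite E add0r -[j]addr0 -E [in LHS]P addr0; ring.
Qed.

End HalfIntegers.

(** * Coordinates of brackets and the center *)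

Section Coordinates.
Variable R : realType.
Local Notation C := R[i].
Local Notation D := (mhv R).
Local Notation e b := (mhv_vec R b).
Implicit Types (x y z : D) (m n p j k q : int).

(** The central coefficient of [[L_m, L_(-m)]]. *)
Definition virasoro_cocycle m : C := (m%:~R ^+ 3 - m%:~R) / 12.

Lemma mhv_coord_ext x y : (forall b, coeff b x = coeff b y) -> x = y.
Proof. by move=> E; apply/eqP/freeg_eqP. Qed.

Lemma coeff_vec a b : coeff a (e b) = (b == a)%:R :> C.
Proof. by rewrite coeffU mul1r. Qed.

(** To identify the coordinates of [lie x y] as functions of [x], it is enough to
    evaluate them at the basis; the formulas [coeff_lie_*] below rest on this. *)
Lemma mhv_linear_form (u : D -> C) (v : D -> C) :
  (forall a x y, u (a *: x + y) = a * u x + u y) ->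
  (forall a x y, v (a *: x + y) = a * v x + v y) ->
  (forall b, u (e b) = v (e b)) -> u =1 v.
Proof. exact: (@freeg_linear_ext C mhv_basis C^o). Qed.

Let coeff_lin (c : C) b r x y :
  c * coeff b (r *: x + y) = r * (c * coeff b x) + c * coeff b y :> C.
Proof. by rewrite coeffD coeffZ mulrDr mulrCA. Qed.

Let lie_lin a b r x y :
  coeff b (lie (r *: x + y) (e a)) = r * coeff b (lie x (e a)) + coeff b (lie y (e a)) :> C.
Proof. by rewrite (lie_linearl (e a)) coeffD coeffZ. Qed.

Lemma mhv_basis_eqE :
  (forall m n, (L_ m == L_ n) = (m == n)) * (forall m n, (I_ m == I_ n) = (m == n)) *
  (forall m n, (L_ m == I_ n) = false) * (forall m n, (I_ m == L_ n) = false) *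
  (forall m, (L_ m == c_) = false) * (forall m, (L_ m == l_) = false) *
  (forall m, (c_ == L_ m) = false) * (forall m, (l_ == L_ m) = false) *
  (forall m, (I_ m == c_) = false) * (forall m, (I_ m == l_) = false) *
  (forall m, (c_ == I_ m) = false) * (forall m, (l_ == I_ m) = false) *
  ((c_ == l_) = false) * ((l_ == c_) = false).
Proof. by []. Qed.

Ltac coord :=
  match goal with |- coeff _ (lie ?x _) = _ => move: x end;
  apply: mhv_linear_form;
  [ exact: lie_lin
  | first [exact: coeff_lin | by move=> *; rewrite mulr0 addr0]
  | case=> [?||?|]; rewrite mhv_lieE /= ?(coeffD, coeffZ, coeffN, coeff_vec, coeff0)
      ?mhv_basis_eqE ?eqxx ?(mulr0, addr0, mulr1, add0r) // ].

Ltac case_eqs :=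
  repeat (case: eqP => ? //; try by exfalso; lia); rewrite ?mulr0 ?mulr1 //.

Lemma coeff_lie_L_L x n p :
  coeff (L_ p) (lie x (e (L_ n))) = (p - 2 * n)%:~R * coeff (L_ (p - n)) x.
Proof. by coord; case_eqs; congr (_%:~R); lia. Qed.

Lemma coeff_lie_L_I x n q :
  coeff (I_ q) (lie x (e (L_ n))) = half_int R (q - n) * coeff (I_ (q - n)) x.
Proof. by coord; case_eqs; congr (half_int _ _); lia. Qed.

Lemma coeff_lie_L_c x n :
  coeff c_ (lie x (e (L_ n))) = virasoro_cocycle (- n) * coeff (L_ (- n)) x.
Proof.
coord; case_eqs; rewrite /virasoro_cocycle.
by congr ((_%:~R ^+ 3 - _%:~R) / _); lia.
Qed.

Lemma coeff_lie_L_l x n : coeff l_ (lie x (e (L_ n))) = 0.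
Proof. by coord. Qed.

Lemma coeff_lie_I_L x k p : coeff (L_ p) (lie x (e (I_ k))) = 0.
Proof. by coord. Qed.

Lemma coeff_lie_I_I x k q :
  coeff (I_ q) (lie x (e (I_ k))) = - half_int R k * coeff (L_ (q - k)) x.
Proof. by coord; case_eqs. Qed.

Lemma coeff_lie_I_c x k : coeff c_ (lie x (e (I_ k))) = 0.
Proof. by coord. Qed.

Lemma coeff_lie_I_l x k :
  coeff l_ (lie x (e (I_ k))) = - half_int R k * coeff (I_ (- k - 1)) x.
Proof.
coord; case_eqs; rewrite -half_int_opp.
by congr (half_int _ _); lia.
Qed.

Lemma coeff_lie_c x a : coeff a (lie x (e c_)) = 0.
Proof. by coord. Qed.

Lemma coeff_lie_l x a : coeff a (lie x (e l_)) = 0.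
Proof. by coord. Qed.

Definition central_span : set D :=
  [set a *: e c_ + b *: e l_ | a in [set: C] & b in [set: C]].

Lemma central_spanP x :
  central_span x <-> forall k, coeff (L_ k) x = 0 /\ coeff (I_ k) x = 0.
Proof.
split=> [[a _ [b _ <-]] k|zx].
  by rewrite !coeffD !coeffZ !coeff_vec !mhv_basis_eqE !mulr0 addr0.
exists (coeff c_ x) => //; exists (coeff l_ x) => //.
apply: mhv_coord_ext => -[m||j|]; rewrite !coeffD !coeffZ !coeff_vec !mhv_basis_eqE ?eqxx ?mulr1 ?mulr0 ?addr0 ?add0r //.
- by rewrite (zx m).1.
- by rewrite (zx j).2.
Qed.

Lemma central_span_comb (a : C) (x y : D) :
  central_span x -> central_span y -> central_span (a *: x + y).
Proof.
move=> /central_spanP zx /central_spanP zy; apply/central_spanP => k.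
by have [xL xI] := zx k; have [yL yI] := zy k; rewrite !coeffD !coeffZ xL xI yL yI mulr0 addr0.
Qed.

Lemma central_span0 : central_span (0 : D).
Proof. by apply/central_spanP => k; rewrite !coeff0. Qed.

Lemma central_span_c : central_span (e c_).
Proof. by apply/central_spanP => k; rewrite !coeff_vec. Qed.

Lemma central_span_l : central_span (e l_).
Proof. by apply/central_spanP => k; rewrite !coeff_vec. Qed.

(** All coordinates of [lie x (e b)] only involve the coordinates of [x] along
    the [L]'s and the [I]'s. *)
Lemma lie_central x y : central_span x -> lie x y = 0.
Proof.
move=> /central_spanP zx; move: y; apply: freeg_linear_ext => [||b].
- by move=> k u v; exact: (lie_linearr x).
- by move=> k u v; rewrite scaler0 addr0.
rewrite -/(mhv_vec R b); apply: mhv_coord_ext => a; rewrite coeff0.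
have zL m := (zx m).1; have zI j := (zx j).2.
by case: b => [n||k|]; case: a => [p||q|];
  rewrite ?(coeff_lie_L_L, coeff_lie_L_I, coeff_lie_L_c, coeff_lie_L_l,
            coeff_lie_I_L, coeff_lie_I_I, coeff_lie_I_c, coeff_lie_I_l)
          ?(zL, zI) ?(coeff_lie_c, coeff_lie_l) ?mulr0.
Qed.

(** Bracketing with [L_0] multiplies each coordinate by its degree, which is zero
    only at [L_0] among the non-central vectors; [L_1] detects that one. *)
Lemma central_of_lie x :
  central_span (lie x (e (L_ 0))) -> central_span (lie x (e (L_ 1))) ->
  central_span x.
Proof.
move=> /central_spanP z0 /central_spanP z1; apply/central_spanP => k.
have := (z0 k).1; have := (z0 k).2.
rewrite coeff_lie_L_I coeff_lie_L_L mulr0 subr0 => /eqP.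
rewrite mulf_eq0 (negPf (half_int_neq0 _ _)) /= => /eqP zI /eqP.
rewrite mulf_eq0 intr_eq0 => /orP zL; split=> //.
case: zL => /eqP // ->; have := (z1 1).1.
by rewrite coeff_lie_L_L subrr mulr1 => /eqP; rewrite mulf_eq0 => /orP[|/eqP//]; rewrite intr_eq0.
Qed.

End Coordinates.

(** * Coefficient relations and rigidity *)

Section Rigidity.
Variable R : realType.
Local Notation C := R[i].
Local Notation D := (mhv R).
Local Notation e b := (mhv_vec R b).
Local Notation half := (half_int R).
Implicit Types (f g h : D -> D) (m n p j k q d : int).

(** The defining identity with [f (e a)] and [g (e b)] both on the left of a bracket
    with a basis vector, the shape to which [coeff_lie_*] applies. *)
Lemma Delta_coeff f g h a b i : Delta D (f, g, h) ->
  coeff i (lie (f (e a)) (e b)) - coeff i (lie (g (e b)) (e a)) =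
  coeff i (h (mhv_lie_basis R a b)).
Proof. by case=> _ _ _ De; rewrite -mhv_lieE -De coeffD (lieC (e a)) coeffN. Qed.

Lemma Delta_linear f g h : Delta D (f, g, h) -> linear h.
Proof. by case. Qed.

(** Dividing the identity for [[L_m, I_r]] by [-r], which never vanishes, leaves a
    right-hand side that depends on [m + j] only. *)
Lemma Delta_LI_I f g h d m j : Delta D (f, g, h) ->
  coeff (L_ (m + d)) (f (e (L_ m))) +
    half (j + d) / half j * coeff (I_ (j + d)) (g (e (I_ j))) =
  coeff (I_ (m + j + d)) (h (e (I_ (m + j)))).
Proof.
move=> De; apply: (mulfI (half_int_neq0 R j)); apply: oppr_inj.
have := Delta_coeff (L_ m) (I_ j) (I_ (m + j + d)) De.
rewrite /= (linear_mapZ (Delta_linear De)) coeffZ mulNr => <-.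
rewrite coeff_lie_I_I coeff_lie_L_I.
have -> : m + j + d - j = m + d by lia.
have -> : m + j + d - m = j + d by lia.
by field; exact: half_int_neq0.
Qed.

Lemma Delta_affine f g h d : Delta D (f, g, h) ->
  let phi m := coeff (L_ (m + d)) (f (e (L_ m))) in
  let psi j := half (j + d) / half j * coeff (I_ (j + d)) (g (e (I_ j))) in
  let s := phi 1 - phi 0 in
  (forall m, phi m = phi 0 + s * m%:~R) /\ (forall j, psi j = psi 0 + s * j%:~R).
Proof.
move=> De phi psi.
apply: (@affine_of_sum R phi psi (fun s => coeff (I_ (s + d)) (h (e (I_ s))))).
by move=> m j; exact: Delta_LI_I.
Qed.

(** The [l_]-coefficient of [[f L_m, I_r]] picks the coordinate of [f L_m] at
    [I_(-r)]; on the other side stands [-r] times the [l_]-coefficient of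
    [h I_(m+r)], and [m + r] is the opposite of the degree shift. *)
Lemma Delta_LI_coeff f g h m d : Delta D (f, g, h) ->
  coeff (I_ (m + d)) (f (e (L_ m))) = coeff (I_ d) (f (e (L_ 0))).
Proof.
move=> De; suff E n : coeff (I_ (n + d)) (f (e (L_ n))) = coeff l_ (h (e (I_ (- d - 1)))).
  by rewrite E -(E 0) add0r.
set j := - (n + d) - 1.
have := Delta_coeff (L_ n) (I_ j) l_ De.
rewrite /= (linear_mapZ (Delta_linear De)) coeffZ coeff_lie_I_l coeff_lie_L_l subr0.
have -> : - j - 1 = n + d by lia.
have -> : n + j = - d - 1 by lia.
by apply: mulfI; rewrite oppr_eq0 half_int_neq0.
Qed.

(** Write [gam k] for the coefficient in shift [d]; taking the second vector of
    the pair to be [I_ k], the relation is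
    [(2 k + d - s) gam k = half k * eta s].  At [s = 2 k + d] it gives
    [eta s = 0]; using this zero for [k = j + 1] in the relation for [k = j]
    gives [gam j = 0]. *)
Lemma Delta_IL_coeff f g h j p : Delta D (f, g, h) ->
  coeff (L_ p) (f (e (I_ j))) = 0.
Proof.
move=> /Delta_swap De; set d := p - j.
have -> : p = j + d by lia.
pose gam k := coeff (L_ (k + d)) (f (e (I_ k))).
pose eta s := coeff (L_ (s + d)) (h (e (I_ s))).
have E s k : (2 * k + d - s)%:~R * gam k = half k * eta s.
  have := Delta_coeff (L_ (s - k)) (I_ k) (L_ (s + d)) De.
  rewrite /= (linear_mapZ (Delta_linear De)) coeffZ coeff_lie_I_L coeff_lie_L_L sub0r mulNr.
  have -> : s - k + k = s by lia.
  have -> : s + d - (s - k) = k + d by lia.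
  have -> : s + d - 2 * (s - k) = 2 * k + d - s by lia.
  by move/oppr_inj.
have eta0 k : eta (2 * k + d) = 0.
  have /eqP := E (2 * k + d) k; rewrite subrr mul0r eq_sym mulf_eq0.
  by rewrite (negPf (half_int_neq0 _ _)) => /eqP.
have /eqP := E (2 * (j + 1) + d) j; rewrite eta0 mulr0 mulf_eq0 intr_eq0.
by case/orP => [|/eqP //]; lia.
Qed.

Lemma Delta_LL_L f g h d m n : Delta D (f, g, h) -> m + n != 0 ->
  (m - n + d)%:~R * coeff (L_ (m + d)) (f (e (L_ m))) -
  (n - m + d)%:~R * coeff (L_ (n + d)) (g (e (L_ n))) =
  (m - n)%:~R * coeff (L_ (m + n + d)) (h (e (L_ (m + n)))).
Proof.
move=> De /negPf mn0.
have := Delta_coeff (L_ m) (L_ n) (L_ (m + n + d)) De.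
rewrite /= mn0 scale0r addr0 (linear_mapZ (Delta_linear De)) coeffZ !coeff_lie_L_L => <-.
have -> : m + n + d - n = m + d by lia.
have -> : m + n + d - m = n + d by lia.
by congr (_%:~R * _ - _%:~R * _); lia.
Qed.

Lemma Delta_LL_c f g h d m : Delta D (f, g, h) -> d != 0 ->
  virasoro_cocycle R (m + d) * coeff (L_ (m + d)) (f (e (L_ m))) -
  virasoro_cocycle R (- m) * coeff (L_ (- m)) (g (e (L_ (- m - d)))) =
  (2 * m + d)%:~R * coeff c_ (h (e (L_ (- d)))).
Proof.
move=> De /negPf d0.
have := Delta_coeff (L_ m) (L_ (- m - d)) c_ De.
rewrite /= (_ : m + (- m - d) = - d); last by lia.
rewrite oppr_eq0 d0 scale0r addr0 (linear_mapZ (Delta_linear De)) coeffZ !coeff_lie_L_c.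
have -> : - (- m - d) = m + d by lia.
by move=> ->; congr (_%:~R * _); lia.
Qed.

Lemma Delta_II_l f g h d j : Delta D (f, g, h) -> d != 0 ->
  half (j + d) * coeff (I_ (j + d)) (f (e (I_ j))) +
  half j * coeff (I_ (- j - 1)) (g (e (I_ (- j - d - 1)))) = 0.
Proof.
move=> De /negPf d0.
have := Delta_coeff (I_ j) (I_ (- j - d - 1)) l_ De.
rewrite /= (_ : j + (- j - d - 1) + 1 == 0 = false); last by apply/negbTE; lia.
rewrite scale0r (linear_map0 (Delta_linear De)) coeff0 !coeff_lie_I_l.
have -> : - (- j - d - 1) - 1 = j + d by lia.
have -> : - j - d - 1 = - (j + d) - 1 by lia.
by rewrite half_int_opp opprK mulNr opprK.
Qed.

(** Both coefficients are affine in [m].  Comparing the two sides at [m = n] shows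
    that they agree, and [f] has coefficient 0 at [L_0], so both are [s m].  Modulo the center every such [s] is allowed: it is
    the cubic term of the cocycle that excludes it. *)
Lemma Delta_LL_off f g h d : Delta D (f, g, h) -> d != 0 ->
  coeff (L_ d) (f (e (L_ 0))) = 0 -> forall m,
  coeff (L_ (m + d)) (f (e (L_ m))) = 0 /\ coeff (L_ (m + d)) (g (e (L_ m))) = 0.
Proof.
move=> De d0 f0.
pose phi m := coeff (L_ (m + d)) (f (e (L_ m))).
pose phi' m := coeff (L_ (m + d)) (g (e (L_ m))).
have [Ephi _] := Delta_affine d De.
have [Ephi' _] := Delta_affine d (Delta_swap De).
have dC : d%:~R != 0 :> C by rewrite intr_eq0.
have phi0 : phi 0 = 0 by rewrite /phi add0r.
have same m : m != 0 -> phi' m = phi m.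
  move=> m0; have := @Delta_LL_L _ _ _ d m m De.
  rewrite subrr add0r mul0r => E; apply/esym/(mulfI dC)/subr0_eq/E; lia.
set s := phi 1 - phi 0 in Ephi.
have {}Ephi m : phi m = s * m%:~R by rewrite /phi Ephi -/(phi 0) phi0 add0r.
have {}Ephi' m : phi' m = s * m%:~R.
  have [-> | m0] := eqVneq m 0; last by rewrite same.
  have := Ephi' 2; rewrite -/(phi' 2) -/(phi' 1) -/(phi' 0) (same 1) // (same 2) // !Ephi => E.
  have -> : phi' 0 = s * 1%:~R + s * 1%:~R - s * 2%:~R by rewrite E; ring.
  by ring.
(* The case m = 0 of the central coefficient. *)
have w0 : coeff c_ (h (e (L_ (- d)))) = 0.
  apply: (mulfI dC); rewrite mulr0.
  transitivity ((2 * 0 + d)%:~R * coeff c_ (h (e (L_ (- d))))); first by ring.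
  rewrite -(@Delta_LL_c _ _ _ d 0 De d0) -/(phi 0) phi0 /virasoro_cocycle oppr0.
  by field.
(* The case m = d: the terms linear in the index cancel and d ^ 4 / 2 remains. *)
have s0 : s = 0.
  have := @Delta_LL_c _ _ _ d d De d0; rewrite w0 mulr0 -/(phi d).
  have -> : coeff (L_ (- d)) (g (e (L_ (- d - d)))) = phi' (- d - d).
    by rewrite /phi'; congr (coeff (L_ _) _); lia.
  rewrite Ephi Ephi' => E; have /eqP : s * (d%:~R ^+ 4 / 2) = 0.
    by rewrite -E /virasoro_cocycle; field.
  rewrite mulf_eq0 mulf_eq0 expf_eq0 (negPf dC) invr_eq0 pnatr_eq0 andbF !orbF.
  by move/eqP.
by move=> m; rewrite -/(phi m) -/(phi' m) Ephi Ephi' s0 mul0r.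
Qed.

(** Once the part on the [L]'s vanishes, the coefficients on the [I]'s are
    [b r / (r + d)] and [b' r / (r + d)] at [I_r] for [f] and [g].  The form [[I_r, I_s]]
    turns this into [(b + b') r + b' d = 0] for all half-integers [r]. *)
Lemma Delta_II_off f g h d : Delta D (f, g, h) -> d != 0 ->
  coeff (L_ d) (f (e (L_ 0))) = 0 -> forall j,
  coeff (I_ (j + d)) (f (e (I_ j))) = 0.
Proof.
move=> De d0 f0 j.
have offL := Delta_LL_off De d0 f0.
have hn k := half_int_neq0 R k.
have cst u v w : Delta D (u, v, w) ->
    (forall m, coeff (L_ (m + d)) (u (e (L_ m))) = 0) ->
  exists b, forall k, half (k + d) * coeff (I_ (k + d)) (v (e (I_ k))) = b * half k.
  move=> Du u0; have [_ E] := Delta_affine d Du.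
  eexists => k; apply: (mulIf (invr_neq0 (hn k))); rewrite mulfK //.
  by rewrite mulrAC E !u0 subrr mul0r addr0.
have [b' Eg] := cst _ _ _ De (fun m => (offL m).1).
have [b Ef] := cst _ _ _ (Delta_swap De) (fun m => (offL m).2).
(* Pair I_r with I_(-r-d), whose image under g is a multiple of I_(-r). *)
have E k : (b + b') * half k + b' * d%:~R = 0.
  have := Delta_II_l k De d0; rewrite Ef.
  have := Eg (- k - d - 1); have -> : - k - d - 1 + d = - k - 1 by lia.
  rewrite half_int_opp mulNr => /(canRL (@opprK _)) ->.
  have -> : - k - d - 1 = - (k + d) - 1 by lia.
  by rewrite half_int_opp => <-; rewrite /half_int; ring.
have bb' : b + b' = 0.
  have <- : (b + b') * half 1 + b' * d%:~R - ((b + b') * half 0 + b' * d%:~R) = b + b'.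
    by rewrite /half_int; ring.
  by rewrite !E subrr.
have /eqP := E 0; rewrite bb' mul0r add0r mulf_eq0 intr_eq0 (negPf d0) orbF => /eqP b'0.
have b0 : b = 0 by rewrite -bb' b'0 addr0.
by have /eqP := Ef j; rewrite b0 mul0r mulf_eq0 (negPf (hn _)) => /eqP.
Qed.

(** The slope of [f] on the [I]'s is, by [Delta_affine] for the swapped triple,
    the slope of [g] on the [L]'s; the pairs [(2, 1)] and [(3, 0)], of equal sum,
    show that it is also the slope of [f] on the [L]'s. *)
Lemma Delta_diag f g h : Delta D (f, g, h) -> exists a b s : C,
  (forall m, coeff (L_ m) (f (e (L_ m))) = a + s * m%:~R) /\
  (forall j, coeff (I_ j) (f (e (I_ j))) = b + s * half j).
Proof.
move=> De.
have [Ephi _] := Delta_affine 0 De.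
have [Ephi' Epsi] := Delta_affine 0 (Delta_swap De).
pose phi m := coeff (L_ m) (f (e (L_ m))).
pose phi' m := coeff (L_ m) (g (e (L_ m))).
have {}Ephi m : phi m = phi 0 + (phi 1 - phi 0) * m%:~R.
  by have := Ephi m; rewrite !addr0.
have {}Ephi' m : phi' m = phi' 0 + (phi' 1 - phi' 0) * m%:~R.
  by have := Ephi' m; rewrite !addr0.
have slope : phi' 1 - phi' 0 = phi 1 - phi 0.
  have := @Delta_LL_L _ _ _ 0 3 0 De isT.
  have := @Delta_LL_L _ _ _ 0 2 1 De isT.
  rewrite !addr0 -!/(phi _) -!/(phi' _) (Ephi 2) (Ephi 3).
  rewrite -[2 + 1]/(3 : int) => E1 E2; apply/subr0_eq.
  have three : 3 != 0 :> C by rewrite pnatr_eq0.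
  apply/(mulfI three); rewrite mulr0; apply: etrans (subrr (3 * coeff (L_ 3) (h (e (L_ 3))))).
  have <- : (3 - 0)%:~R * coeff (L_ 3) (h (e (L_ 3))) = 3 * coeff (L_ 3) (h (e (L_ 3))) by [].
  rewrite -{2}E2; have -> : 3 * coeff (L_ 3) (h (e (L_ 3))) = 3 * ((2 - 1)%:~R * coeff (L_ 3) (h (e (L_ 3)))) by ring.
  by rewrite -E1; ring.
exists (phi 0), (coeff (I_ 0) (f (e (I_ 0))) - (phi 1 - phi 0) / 2), (phi 1 - phi 0).
split=> [m|j]; first exact: Ephi.
have := Epsi j; rewrite !addr0 !divff ?half_int_neq0 // !mul1r => ->.
by rewrite -!/(phi' _) slope /half_int; field.
Qed.

End Rigidity.

(** * The decomposition *)

Section Decomposition.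
Variable R : realType.
Local Notation C := R[i].
Local Notation D := (mhv R).
Local Notation e b := (mhv_vec R b).
Local Notation half := (half_int R).
Implicit Types (f g h : D -> D) (m n p j k q d : int).

Lemma subspace_Ann : subspace (Ann R).
Proof.
split; first by split=> [k u v|x]; [rewrite /= scaler0 addr0|exact: central_span0].
move=> a f g [lf zf] [lg zg]; split; first exact: linear_comb.
by move=> x; exact: (central_span_comb a (zf x) (zg x)).
Qed.

Lemma Ann_generalized f : Ann R f -> generalized_derivations D f.
Proof.
move=> [lf zf]; exists 0, 0.
have l0 : linear (0 : D -> D) by move=> k u v; rewrite /= scaler0 addr0.
split=> // x y.
by rewrite (lie_central _ (zf x)) (linear_map0 (lie_linearr _)) addr0.
Qed.

Lemma Ann_basis f : linear f -> (forall b, central_span (f (e b))) -> Ann R f.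
Proof.
move=> lf zf; split=> // x; apply/central_spanP => k.
have Z i : (forall b, coeff i (f (e b)) = 0) -> coeff i (f x) = 0.
  move=> zi; move: x; apply: (mhv_linear_form (v := fun _ => 0)) => //.
  - by move=> a x y; rewrite lf coeffD coeffZ.
  - by move=> *; rewrite mulr0 addr0.
by split; apply: Z => b; have /central_spanP/(_ k)[] := zf b.
Qed.

(** Brackets with [z] vanish, so the identity reduces to [[f z, y] = 0]. *)
Lemma Delta_central f g h z : Delta D (f, g, h) ->
  central_span z -> central_span (f z).
Proof.
move=> [_ _ lh De] zz; have E y : lie (f z) y = 0.
  by have := De z y; rewrite !(lie_central _ zz) addr0 (linear_map0 lh).
by apply: central_of_lie; rewrite E; exact: central_span0.
Qed.

Lemma coeff_diag (w : mhv_basis -> C) (x : D) i :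
  coeff i (fglift (fun b => w b *: e b) x : D) = w i * coeff i x.
Proof.
move: x; apply: mhv_linear_form.
- by move=> a x y; rewrite fglift_linear coeffD coeffZ.
- by move=> a x y; rewrite coeffD coeffZ mulrDr mulrCA.
- move=> b; rewrite liftU scale1r coeffZ coeff_vec.
  by case: eqP => [->//|]; rewrite !mulr0.
Qed.

(** In the coordinates of degree [r != 0], [ad x] maps [L_0] to [r] times the
    coordinate of [x]: divide by [r].  Only finitely many coordinates of [y] are
    nonzero, so [x] exists. *)
Lemma exists_inner_part (y : D) : exists x : D,
  (forall n, n != 0 -> coeff (L_ n) (lie x (e (L_ 0))) = coeff (L_ n) y) /\
  (forall q, coeff (I_ q) (lie x (e (L_ 0))) = coeff (I_ q) y).
Proof.
(* At L_0 the weight is the inverse of 0; no condition is imposed there. *)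
pose w b : C := match b with L_ n => n%:~R^-1 | I_ q => (half q)^-1 | _ => 0 end.
exists (fglift (fun b => w b *: e b) y); split=> [n n0|q].
  by rewrite coeff_lie_L_L mulr0 !subr0 coeff_diag mulVKf // intr_eq0.
by rewrite coeff_lie_L_I !subr0 coeff_diag mulVKf // half_int_neq0.
Qed.

(** [ad L_0] acts by [- m] on [L_ m] and by [- r] on [I_r], so the slope found in
    [Delta_diag] is absorbed by [- s ad L_0], and [tau] corrects the constant term
    on the [I]'s. *)
Lemma Delta_normal_form f g h : Delta D (f, g, h) ->
  (forall n, n != 0 -> coeff (L_ n) (f (e (L_ 0))) = 0) ->
  (forall q, coeff (I_ q) (f (e (L_ 0))) = 0) ->
  exists t a s : C,
    Ann R ((-1) *: (t *: @tau R + (a *: idfun + lie (s *: e (L_ 0)))) + f).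
Proof.
move=> De fL fI; have [a [b [s [dL dI]]]] := Delta_diag De.
exists (b - a), a, (- s).
have lf : linear f by case: De.
apply: Ann_basis => [|i].
  apply: linear_comb lf; apply: linear_comb; first exact: tau_linear.
  by apply: linear_comb => //; exact: lie_linearr.
have adL0 : lie (- s *: e (L_ 0)) (e i) = - s *: mhv_lie_basis R (L_ 0) i.
  by rewrite (linear_mapZ (lie_linearl _)) mhv_lieE.
rewrite !fctE adL0 tauE; case: i {adL0} => [m||j|] /=.
- apply/central_spanP => k.
  rewrite !(coeffD, coeffZ, coeff0, coeff_vec) !mhv_basis_eqE !add0r; split.
    have [<-|mk] := eqVneq m k; first by rewrite dL /= mulr0 (mulr0 (if _ then _ else _)); ring.
    have -> : k = m + (k - m) by lia.
    have nz : k - m != 0 by rewrite subr_eq0 eq_sym.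
    rewrite (Delta_LL_off De nz (fL _ nz) m).1; rewrite /= ?(mulr0, addr0) //.
  have -> : k = m + (k - m) by lia.
  rewrite (Delta_LI_coeff _ _ De) fI /= !(mulr0, addr0) //.
- apply: (central_span_comb _ _ (Delta_central De (central_span_c R))).
  apply: (central_span_comb _ (central_span0 R)).
  by rewrite scaler0; exact: (central_span_comb _ (central_span_c R) (central_span0 R)).
- apply/central_spanP => k.
  rewrite !(coeffD, coeffZ, coeff0, coeff_vec) !mhv_basis_eqE !add0r; split.
    rewrite (Delta_IL_coeff _ _ De); rewrite /= ?(mulr0, addr0) //.
  have [<-|jk] := eqVneq j k; first (rewrite dI /= ?mulr1; ring).
  have -> : k = j + (k - j) by lia.
  have nz : k - j != 0 by rewrite subr_eq0 eq_sym.
  rewrite (Delta_II_off De nz (fL _ nz) j); rewrite /= ?(mulr0, addr0) //.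
- rewrite scalerA; apply: (central_span_comb _ _ (Delta_central De (central_span_l R))).
  apply: (central_span_comb _ (central_span_l R)).
  by rewrite scaler0; exact: (central_span_comb _ (central_span_l R) (central_span0 R)).
Qed.

Lemma generalized_derivation_decomposition f : generalized_derivations D f ->
  exists (t a : C) (x : D) g, Ann R g /\ f = t *: @tau R + a *: idfun + lie x + g.
Proof.
move=> Gf; have [x [xL xI]] := exists_inner_part (f (e (L_ 0))).
have Gx := derivation_generalized (inner_derivation x).
have [g [h De]] := generalized_derivation_comb (-1) Gx Gf.
have [||t [a [s Gc]]] := Delta_normal_form De.
- by move=> n n0; rewrite !fctE scaleN1r coeffD coeffN xL // addNr.
- by move=> q; rewrite !fctE scaleN1r coeffD coeffN xI addNr.
exists t, a, (x + s *: e (L_ 0)); eexists; split; first exact: Gc.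
apply/funext => y; rewrite !fctE (linear_mapD (lie_linearl y)).
have regroup (V : lmodType C) (u1 u2 u3 u4 v : V) :
    v = u1 + u2 + (u3 + u4) + ((-1) *: (u1 + (u2 + u4)) + ((-1) *: u3 + v)).
  rewrite !scaleN1r (addrA (- _)) -opprD.
  have -> : u1 + (u2 + u4) + u3 = u1 + u2 + (u3 + u4) by rewrite -!addrA [u4 + _]addrC.
  by rewrite addrA subrr add0r.
exact: regroup.
Qed.

(** The coordinate at [L_0] of the value at [L_0] is [a], since [[x, L_0]] has no
    such coordinate.  With [a = 0], [tau] is invisible on the [L]'s, so [x] is central
    by [central_of_lie], and the value at [I_0] gives [t]. *)
Lemma summands_independent (t a : C) (x : D) g : Ann R g ->
  t *: @tau R + a *: idfun + lie x + g = 0 ->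
  [/\ t = 0, a = 0, lie x = 0 & g = 0].
Proof.
move=> [lg zg] E.
have Ey y : t *: tau y + a *: y + lie x y = - g y.
  by apply/eqP; rewrite -addr_eq0; apply/eqP; exact: (congr1 (fun u => u y) E).
have Ez y : central_span (t *: tau y + a *: y + lie x y).
  by rewrite Ey -scaleN1r -[_ *: _]addr0; exact: (central_span_comb _ (zg y) (central_span0 R)).
have a0 : a = 0.
  have /central_spanP/(_ 0)[+ _] := Ez (e (L_ 0)).
  rewrite !coeffD !coeffZ coeff_lie_L_L tauE /= coeff0 coeff_vec eqxx.
  by rewrite !mulr0 subr0 mul0r add0r addr0 mulr1.
have lieL m : central_span (lie x (e (L_ m))).
  by have := Ez (e (L_ m)); rewrite a0 tauE /= scaler0 scale0r !add0r.
have x0 : lie x = 0.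
  by apply/funext => y; exact: lie_central (central_of_lie (lieL 0) (lieL 1)).
have t0 : t = 0.
  have /central_spanP/(_ 0)[_] := Ez (e (I_ 0)).
  by rewrite x0 a0 scale0r !addr0 tauE /= coeffZ coeff_vec eqxx mulr1.
split=> //; move: E; rewrite t0 a0 x0 !scale0r !add0r //.
Qed.

End Decomposition.

Theorem theorem1p1 (R : realType) :
  internal_direct_sum
    [:: line (@tau R); line (@idfun (mhv R));
        inner_derivations (mhv R); Ann R]
    (generalized_derivations (mhv R)).
Proof.
have comb := @generalized_derivation_comb _ (mhv R).
have add u v : generalized_derivations (mhv R) u -> generalized_derivations (mhv R) v ->
    generalized_derivations (mhv R) (u + v).
  by move=> Gu Gv; rewrite -[u]scale1r; exact: comb.
have scale a v : generalized_derivations (mhv R) v -> generalized_derivations (mhv R) (a *: v).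
  by move=> Gv; rewrite -[_ *: v]addr0; apply: comb => //; exact: generalized_derivation0.
apply: internal_direct_sum4.
- split; [exact: subspace_line | exact: subspace_line | | exact: subspace_Ann].
  exact: subspace_inner_derivations.
- move=> _ _ _ u4 [t _ <-] [a _ <-] [x _ <-] Au4.
  have Gtau := scale t _ (derivation_generalized (tau_derivation R)).
  have Gid := scale a _ (id_generalized (mhv R)).
  have Gad := derivation_generalized (inner_derivation x).
  exact: (add _ _ (add _ _ (add _ _ Gtau Gid) Gad) (Ann_generalized Au4)).
- move=> f /generalized_derivation_decomposition[t [a [x [g [Ag ->]]]]].
  exists (t *: @tau R), (a *: idfun), (lie x), g; split=> //.
  by split=> //; [exists t | exists a | exists x].
- move=> _ _ _ g [t _ <-] [a _ <-] [x _ <-] Ag E.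
  have [-> -> -> ->] := summands_independent Ag E.
  by rewrite !scale0r.
Qed.
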